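(* There exists an absolute constant $\alpha_2>0$ such that for every metric space $\mathbb{X}$ equipped with a Radon measure $\mu$, every two-parameter system $\{f_{i,j}\}_{(i,j)\in\mathbb{N}^2}$ of real-valued functions on $\mathbb{X}$ that is orthonormal with respect to $\mu$, every sequence of real numbers $\{c_{i,j}\}_{(i,j)\in\mathbb{N}^2}$, and every $N\in\mathbb{N}$, $$\int_{\mathbb{X}}\ \sup_{Tri_{a,b}\subset Tri_{N,N}}\left|\sum_{(i,j)\in Tri_{a,b}} c_{i,j}f_{i,j}(x)\right|^2 d\mu\ \le\ \alpha_2^2\cdot N^{\frac{\ln(2+\sqrt{3})}{\ln 2}}\cdot\left(\sum_{(i,j)\in Tri_{N,N}}|c_{i,j}|^2\right),$$ where the supremum is over all $a,b\ge 0$ with $Tri_{a,b}\subset Tri_{N,N}$.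
   Context: $\mathbb{N}=\{1,2,3,\dots\}$. A system $\{f_{i,j}\}_{(i,j)\in\mathbb{N}^2}$ of (measurable, square-integrable) functions $f_{i,j}:\mathbb{X}\to\mathbb{R}$ is orthonormal if $\int_{\mathbb{X}} f_{i,j}f_{i',j'}\,d\mu=1$ when $(i,j)=(i',j')$ and $\int_{\mathbb{X}} f_{i,j}f_{i',j'}\,d\mu=0$ when $(i,j)\ne(i',j')$. For $0\le a,b<+\infty$, $Tri_{a,b}\subset\mathbb{R}^2$ denotes the (closed, filled) right triangle with vertices $(0,0)$, $(a,0)$, $(0,b)$. Sums over $(i,j)\in Tri_{a,b}$ run over the finitely many pairs $(i,j)\in\mathbb{N}^2$ lying in $Tri_{a,b}$. *)

(* Defs.v *)
From HB Require Import structures.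
From mathcomp Require Import all_boot all_order all_algebra.
From mathcomp Require Import all_classical all_reals all_analysis.

Set Implicit Arguments.
Unset Strict Implicit.
Unset Printing Implicit Defensive.
Import Order.TTheory GRing.Theory Num.Theory.
Import numFieldNormedType.Exports.

Local Open Scope classical_set_scope.
Local Open Scope ring_scope.

(* [measurableType] requires a pointed carrier; nothing is lost, since the
   empty space carries no orthonormal system. *)
#[short(type="pmetricType")]
HB.structure Definition PointedMetric (R : numDomainType) :=
  {X of Metric R X & Pointed X}.

(* [mu] lives on a sigma-algebra [S] that contains the open sets: the Borel
   sets ([S := <<s open>>]), or a larger one such as that of all sets
   measurable for the associated outer measure. The measurable sets of
   [g_sigma_algebraType S] are those of the sigma-algebra generated by [S],
   i.e. the members of [S]. *)
Definition radon (R : realType) (X : pmetricType R) (S : set_system X)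
    (mu : set (g_sigma_algebraType S) -> \bar R) : Prop :=
  [/\ forall K : set X, compact K -> (mu K < +oo)%E,
      forall A : set X, S A ->
        mu A = ereal_inf [set mu U | U in [set U : set X | open U /\ A `<=` U]]
    & forall U : set X, open U ->
        mu U =
          ereal_sup [set mu K | K in [set K : set X | compact K /\ K `<=` U]]].

Definition posidx : set (nat * nat) := [set p | (0 < p.1)%N /\ (0 < p.2)%N].

Definition orthonormal_system d (T : measurableType d) (R : realType)
    (mu : {measure set T -> \bar R}) (f : nat * nat -> T -> R) : Prop :=
  (forall p, posidx p -> f p \in Lfun mu 2%:E) /\
  (forall p q, posidx p -> posidx q ->
    (\int[mu]_x (f p x * f q x)%:E)%E = (if p == q then 1 else 0)%E).

(* The convex hull of (0, 0), (a, 0) and (0, b), also for a = 0 or b = 0. *)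
Definition tri (R : realType) (a b : R) : set (R * R) :=
  [set z | exists s t : R,
    [/\ 0 <= s, 0 <= t, s + t <= 1 & z = (s * a, t * b)]].

Definition tri_idx (R : realType) (a b : R) : set (nat * nat) :=
  posidx `&` [set p | tri a b (p.1%:R, p.2%:R)].

(* Sums over [tri_idx a b] are written with the finitely supported big
   operator, whose value is junk when the support is infinite. *)
Lemma finite_tri_idx (R : realType) (a b : R) : 0 <= a -> 0 <= b ->
  finite_set (tri_idx a b).
Proof.
move=> a0 b0; pose n := (Num.truncn (a + b)).+1.
apply: (@sub_finite_set _ _ (`I_n `*` `I_n)); last exact: finite_setX.
have abn : a + b < n%:R by rewrite /n truncnS_gt.
move=> [i j] [_ [s [t [s0 t0 st [ia jb]]]]]; split=> /=;
  rewrite -(ltr_nat R); apply: le_lt_trans abn.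
- by rewrite ia (le_trans (ler_piMl a0 _)) ?lerDl// (le_trans _ st)// lerDl.
- by rewrite jb (le_trans (ler_piMl b0 _)) ?lerDr// (le_trans _ st)// lerDr.
Qed.

(* Main.v *)
Require Import Defs.
From mathcomp Require Import all_boot all_order all_algebra.
From mathcomp Require Import all_classical all_reals all_analysis.
From mathcomp Require Import measurable_realfun lra.
Import Order.TTheory GRing.Theory Num.Theory.
Import numFieldNormedType.Exports.
Local Open Scope classical_set_scope.
Local Open Scope ring_scope.

(** The exponent ln(2 + sqrt 3)/ln 2 is about 1.9, whereas orthogonality alone
    already gives N^(3/2) by an elementary argument.

    Horizontal rows cut a triangle into at most N pieces, and each piece is an
    initial segment of its row: the triangle, as a set of indices, is closed
    under decreasing the first coordinate ([tri_le], [downset_sum_prefix]). By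
    the Cauchy-Schwarz inequality the square of the sum over the triangle is at
    most N times the sum, over the rows, of the squares of such prefix sums.

    In one row, cut the indices into consecutive blocks of length L, where
    N < L^2. A prefix consists of fewer than L whole blocks followed by fewer
    than L single terms, so two more applications of Cauchy-Schwarz bound its
    square by 2L times [block_sqr], the sum of the squares of all block sums
    plus the sum of the squares of all terms ([sqr_prefix_le]). This bound no
    longer depends on the prefix, hence it also bounds the supremum over all
    triangles. Its integral is computed exactly: by orthonormality each of the
    two sums in [block_sqr] integrates to the sum of the squares of the
    coefficients of the row ([integral_block_sqr]).

    Altogether the integral of the supremum is at most 4NL times the sum of
    the squared coefficients. As L can be chosen at most 2 sqrt N, this is at
    most 8 N^(3/2) times that sum, and 3/2 <= ln(2 + sqrt 3)/ln 2 because
    2^3 <= (2 + sqrt 3)^2 ([exponent_ge]); the constant 3 works since 8 <= 9. *)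

(** * Prefix sums and blocks *)

Lemma sqr_sum_le (R : realDomainType) (I : Type) (s : seq I) (n : nat)
    (g : I -> R) : (size s <= n)%N ->
  (\sum_(i <- s) g i) ^+ 2 <= n%:R * \sum_(i <- s) g i ^+ 2.
Proof.
move=> sn; have Q0 (t : seq I) : 0 <= \sum_(i <- t) g i ^+ 2.
  by apply: sumr_ge0 => i _; exact: sqr_ge0.
(* Summing 2 a (g i) <= a^2 + (g i)^2 controls the cross term of the
   induction step below without a division. *)
have cross (a : R) (t : seq I) : 2 * a * (\sum_(i <- t) g i)
    <= (size t)%:R * a ^+ 2 + \sum_(i <- t) g i ^+ 2.
  elim: t => [|x t ih]; first by rewrite !big_nil mulr0 addr0 mulr_ge0 ?sqr_ge0.
  rewrite !big_cons /= -natr1; have := sqr_ge0 (a - g x); nra.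
apply: (@le_trans _ _ ((size s)%:R * \sum_(i <- s) g i ^+ 2)); last first.
  by apply: ler_wpM2r => //; rewrite ler_nat.
elim: s {sn} => [|x s ih]; first by rewrite !big_nil mulr0 expr0n.
rewrite !big_cons /= -natr1; have := cross (g x) s; nra.
Qed.

Lemma ler_sum_subrange (R : numDomainType) (F : nat -> R) (a b n : nat) :
  (forall i, 0 <= F i) -> (a <= b <= n)%N ->
  \sum_(a <= i < b) F i <= \sum_(0 <= i < n) F i.
Proof.
move=> F0 /andP[ab bn].
have S0 (u v : nat) : 0 <= \sum_(u <= i < v) F i by apply: sumr_ge0.
rewrite (big_cat_nat (leq0n a) (leq_trans ab bn)) /=.
by rewrite (big_cat_nat ab bn) /= addrCA lerDl addr_ge0.
Qed.

(** A majorant, up to the factor [2 * L], of the squares of all prefix sums of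
    [g] of length below [L * L]. The choice of square-root-sized blocks balances
    the number of whole blocks in a prefix against the number of left-over
    terms. *)
Definition block_sqr (R : pzRingType) (L : nat) (g : nat -> R) : R :=
  \sum_(0 <= b < L) (\sum_(b * L <= i < b.+1 * L) g i) ^+ 2
  + \sum_(0 <= i < L * L) g i ^+ 2.

Arguments block_sqr {R} L g.

Lemma block_sqr_ge0 (R : realDomainType) (L : nat) (g : nat -> R) :
  0 <= block_sqr L g.
Proof. by apply: addr_ge0; apply: sumr_ge0 => i _; exact: sqr_ge0. Qed.

(** With m = q L + r, the prefix is made of q < L whole blocks, whose sum is
    [x], and of r < L left-over terms, whose sum is [y]; Cauchy-Schwarz applies
    to each of the two and (x + y)^2 <= 2 x^2 + 2 y^2. *)
Lemma sqr_prefix_le (R : realDomainType) (L m : nat) (g : nat -> R) :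
  (m < L * L)%N ->
  (\sum_(0 <= i < m) g i) ^+ 2 <= 2 * L%:R * block_sqr L g.
Proof.
move=> mL; have L0 : (0 < L)%N by case: L mL.
have qL : (m %/ L < L)%N by rewrite ltn_divLR.
have qm : (m %/ L * L <= m)%N by exact: leq_divM.
rewrite (big_cat_nat (leq0n _) qm) /= big_nat_mul.
set x := \sum_(0 <= b < _) _; set y := \sum_(_ <= i < m) _.
have xle : x ^+ 2 <= L%:R *
    \sum_(0 <= b < L) (\sum_(b * L <= i < b.+1 * L) g i) ^+ 2.
  apply: le_trans (@sqr_sum_le _ _ _ L _ _) _.
    by rewrite size_iota subn0 ltnW.
  apply: ler_wpM2l => //; apply: ler_sum_subrange; last by rewrite /= ltnW.
  by move=> b; exact: sqr_ge0.
have yle : y ^+ 2 <= L%:R * \sum_(0 <= i < L * L) g i ^+ 2.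
  apply: le_trans (@sqr_sum_le _ _ _ L _ _) _.
    by rewrite size_iota {1}(divn_eq m L) addKn ltnW // ltn_mod.
  apply: ler_wpM2l => //; apply: ler_sum_subrange; last by rewrite qm ltnW.
  by move=> i; exact: sqr_ge0.
have := sqr_ge0 (x - y); rewrite /block_sqr; nra.
Qed.

(** The length [m] must not depend on [g]: the same prefix serves every point of
    the measure space. *)
Lemma downset_sum_prefix (R : nmodType) (P : pred nat) (n : nat) :
  (forall i k, (i <= k)%N -> P k -> P i) ->
  exists2 m, (m <= n)%N &
    forall g : nat -> R, \sum_(0 <= i < n | P i) g i = \sum_(0 <= i < m) g i.
Proof.
move=> Pdown; elim: n => [|n [m mn ih]].
  by exists 0%N => // g; rewrite !big_geq.
have [Pn|Pn] := boolP (P n); last first.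
  exists m; first exact: leqW.
  by move=> g; rewrite big_mkcond big_nat_recr //= -big_mkcond ifN // addr0 ih.
exists n.+1 => // g; rewrite [RHS]big_nat_cond [LHS]big_nat_cond.
apply: eq_bigl => i; case: (ltnP i n.+1) => // i_n.
by rewrite /= (Pdown _ _ _ Pn).
Qed.

(** * Integrals of squares of orthonormal combinations *)

Section orthonormal_sequence.
Context {d : measure_display} {T : measurableType d} {R : realType}.
Variables (mu : {measure set T -> \bar R}) (phi : nat -> T -> R).
Hypothesis phi2 : forall i, phi i \in Lfun mu 2%:E.
Hypothesis phi_orth : forall i k,
  (\int[mu]_x (phi i x * phi k x)%:E)%E = (if i == k then 1 else 0)%E.

Lemma measurable_lincomb (s : seq nat) (c : nat -> R) :
  measurable_fun setT (fun x => \sum_(i <- s) c i * phi i x).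
Proof.
apply: measurable_sum => i; apply: measurable_funM => //.
by have /andP[/[!inE]] := phi2 i.
Qed.

Lemma integral_sqr_lincomb (s : seq nat) (c : nat -> R) : uniq s ->
  (\int[mu]_x ((\sum_(i <- s) c i * phi i x) ^+ 2)%:E)%E
  = (\sum_(i <- s) c i ^+ 2)%:E.
Proof.
move=> us.
have int2 i k : mu.-integrable setT (fun x => (phi i x * phi k x)%:E).
  by apply/Lfun1_integrable; exact: Lfun2_mul_Lfun1.
transitivity (\int[mu]_x (\sum_(i <- s) \sum_(k <- s)
    (c i * c k)%:E * (phi i x * phi k x)%:E))%E.
  apply: eq_integral => x _; rewrite expr2 big_distrlr /= -sumEFin.
  apply: eq_bigr => i _; rewrite -sumEFin; apply: eq_bigr => k _.
  by rewrite -EFinM mulrACA.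
rewrite integral_sum //; last first.
  by move=> i; apply: integrable_sum => // k _; exact: integrableZl.
rewrite -sumEFin [LHS]big_seq [RHS]big_seq; apply: eq_bigr => i si.
rewrite integral_sum //; last by move=> k; exact: integrableZl.
rewrite (bigD1_seq i) //= integralZl // phi_orth eqxx mule1.
rewrite big1 ?adde0 ?expr2 // => k ki.
by rewrite integralZl // phi_orth eq_sym (negPf ki) mule0.
Qed.

Lemma measurable_block_sqr (L : nat) (c : nat -> R) :
  measurable_fun setT (fun x => block_sqr L (fun i => c i * phi i x)).
Proof.
apply: measurable_funD; apply: measurable_sum => b; apply: measurable_funX.
  exact: measurable_lincomb.
by under eq_fun do rewrite -[_ * _](big_seq1 +%R b (fun i => c i * phi i _));
  exact: measurable_lincomb.
Qed.

(** The blocks partition the range [0, L * L), so the squares of the block sums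
    integrate to the same total as the squares of the terms, whence the
    factor 2. *)
Lemma integral_block_sqr (L : nat) (c : nat -> R) :
  (\int[mu]_x (block_sqr L (fun i => c i * phi i x))%:E)%E
  = (2 * \sum_(0 <= i < L * L) c i ^+ 2)%:E.
Proof.
have mlin := measurable_lincomb.
(* A single term is the combination over a one-element list, so the second sum
   of [block_sqr] is handled like the sum over blocks. *)
have sqr1 i x : ((c i * phi i x) ^+ 2)%:E
    = ((\sum_(k <- [:: i]) c k * phi k x) ^+ 2)%:E by rewrite big_seq1.
under eq_integral do rewrite /block_sqr EFinD -2!sumEFin.
have msqr (s : seq nat) : measurable_fun setT
    (fun x => ((\sum_(i <- s) c i * phi i x) ^+ 2)%:E).
  by apply/measurable_EFinP; apply: measurable_funX.
have msqr1 i : measurable_fun setT (fun x => ((c i * phi i x) ^+ 2)%:E).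
  by under eq_fun do rewrite sqr1; exact: msqr.
rewrite ge0_integralD //=; first last.
- exact: emeasurable_sum.
- by move=> x _; apply: sume_ge0 => i _; rewrite lee_fin sqr_ge0.
- exact: emeasurable_sum.
- by move=> x _; apply: sume_ge0 => i _; rewrite lee_fin sqr_ge0.
rewrite !ge0_integral_sum //; first last.
- by move=> *; rewrite lee_fin sqr_ge0.
- by move=> *; rewrite lee_fin sqr_ge0.
have int1 i : (\int[mu]_x ((c i * phi i x) ^+ 2)%:E = (c i ^+ 2)%:E)%E.
  under eq_integral do rewrite sqr1.
  by rewrite integral_sqr_lincomb // big_seq1.
have intB b := @integral_sqr_lincomb (index_iota (b * L) (b.+1 * L)) c
  (iota_uniq _ _).
rewrite (eq_bigr _ (fun b _ => intB b)) (eq_bigr _ (fun i _ => int1 i)).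
by rewrite 2!sumEFin -big_nat_mul -EFinD mulr2n mulrDl mul1r.
Qed.

End orthonormal_sequence.

(** The integral of a nonnegative function is a supremum over the simple
    functions below it, hence monotone for all functions. This avoids proving
    that the supremum over all triangles is a measurable function. *)
Lemma ge0_le_integral_nomeas d (T : measurableType d) (R : realType)
    (mu : {measure set T -> \bar R}) (f g : T -> \bar R) :
  (forall x, 0 <= f x)%E -> (forall x, f x <= g x)%E ->
  (\int[mu]_x f x <= \int[mu]_x g x)%E.
Proof.
move=> f0 fg; have g0 x : (0 <= g x)%E by exact: le_trans (f0 x) (fg x).
rewrite !ge0_integralTE //; apply: le_ereal_sup => _ [h hf <-].
by exists h => // x; exact: le_trans (hf x) (fg x).
Qed.

(** * Triangles of indices *)

(** This makes every row of a triangle an initial segment. *)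
Lemma tri_le (R : realType) (a b x x' y : R) :
  0 <= x' <= x -> tri a b (x, y) -> tri a b (x', y).
Proof.
move=> /andP[x'0 x'x] [s [t [s0 t0 st [xE yE]]]].
have [x0|x0] := eqVneq x 0.
  by exists s, t; split; rewrite // -xE -yE; congr (_, _); lra.
have xp : 0 < x by rewrite lt_def x0 (le_trans x'0).
have q0 : 0 <= x' / x by rewrite divr_ge0 // ltW.
have q1 : x' / x <= 1 by rewrite ler_pdivrMr // mul1r.
(* Rescaling the weight of the vertex (a, 0) moves the point horizontally. *)
exists (x' / x * s), t; split => //; [exact: mulr_ge0| |].
  by apply: le_trans st; rewrite lerD2r ler_piMl.
by rewrite -mulrA -xE -yE divfK.
Qed.

Lemma tri_idx_bound (R : realType) (N : nat) (p : nat * nat) :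
  tri_idx (N%:R : R) N%:R p -> (p.1 <= N)%N && (p.2 <= N)%N.
Proof.
case=> _ [s [t [s0 t0 st [p1 p2]]]].
by rewrite -!(ler_nat R) p1 p2 !ler_piMl //; lra.
Qed.

(** Positive indices are written as successors, so that rows and columns are
    numbered from 0 as in the sums over [index_iota]. *)
Lemma fsbig_rows (R : nmodType) (A : set (nat * nat)) (N : nat)
    (F : nat * nat -> R) :
  A `<=` posidx -> (forall p, A p -> (p.1 <= N)%N && (p.2 <= N)%N) ->
  \sum_(p \in A) F p
  = \sum_(0 <= j < N) \sum_(0 <= i < N | (i.+1, j.+1) \in A) F (i.+1, j.+1).
Proof.
move=> Apos AN.
set r := [seq (i.+1, j.+1) | j <- iota 0 N, i <- iota 0 N].
have ur : uniq r.
  apply: allpairs_uniq; rewrite ?iota_uniq // => -[? ?] [? ?] _ _ /=.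
  by case=> -> ->.
rewrite fsbig_mkcond.
transitivity (\sum_(p \in [set` r]) (patch (fun=> 0) A F) p).
  symmetry; apply: fsbig_widen => // -[i j] [_ /= rij]; rewrite patchN //.
  apply/negP; rewrite inE => Aij; apply: rij => /=.
  have := AN _ Aij; case: (Apos _ Aij) => /= i0 j0 /andP[iN jN].
  apply/allpairsP; exists (j.-1, i.-1); rewrite /= !mem_iota !add0n.
  by rewrite !prednK // iN jN.
rewrite -fsbig_seq // /r big_allpairs_dep /index_iota subn0.
by apply: eq_bigr => j _; rewrite [RHS]big_mkcond.
Qed.

(** * The maximal inequality *)

(** Doubling both sides reduces the claim to 2^3 <= (2 + sqrt 3)^2. *)
Lemma exponent_ge (R : realType) : 3 / 2 <= ln (2 + Num.sqrt 3) / ln 2 :> R.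
Proof.
have ln20 : 0 < ln 2 :> R by rewrite ln_gt0 // ltr1n.
have s3 : 0 <= Num.sqrt 3 :> R := sqrtr_ge0 _.
have s32 : Num.sqrt 3 ^+ 2 = 3 :> R by rewrite sqr_sqrtr.
have ln3 : ln (2 ^+ 3) <= ln ((2 + Num.sqrt 3) ^+ 2) :> R.
  by rewrite ler_ln ?posrE; nra.
rewrite ler_pdivlMr //.
by rewrite !lnXn in ln3; lra.
Qed.

Theorem lemma1p10 (R : realType) :
  exists alpha2 : R, 0 < alpha2 /\
  forall (X : pmetricType R) (S : set_system X)
    (mu : {measure set (g_sigma_algebraType S) -> \bar R}),
    sigma_algebra setT S -> (forall U : set X, open U -> S U) -> radon mu ->
  forall f : nat * nat -> g_sigma_algebraType S -> R, orthonormal_system mu f ->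
  forall (c : nat * nat -> R) (N : nat), (0 < N)%N ->
  (\int[mu]_x ereal_sup
      [set y | exists a b : R,
        [/\ (0 <= a)%R, (0 <= b)%R, tri a b `<=` tri N%:R N%:R
          & y = (`|\sum_(p \in tri_idx a b) c p * f p x| ^+ 2)%R%:E]]
   <= (alpha2 ^+ 2 * N%:R `^ (ln (2 + Num.sqrt 3) / ln 2)
        * \sum_(p \in tri_idx (N%:R : R) N%:R) `|c p| ^+ 2)%R%:E)%E.
Proof.
exists 3; split => // X S mu _ _ _ f [f2 forth] c N N0.
(* Outside the large triangle the coefficients are set to 0, which lets every
   row run up to L * L without changing any sum over a triangle inside it. *)
pose A := tri_idx (N%:R : R) N%:R.
pose c' := patch (fun=> 0) A c.
pose L := (Num.truncn (Num.sqrt (N%:R : R))).+1.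
pose row j x := fun i => c' (i.+1, j.+1) * f (i.+1, j.+1) x.
pose K : R := N%:R * (2 * L%:R).
have K0 : 0 <= K by rewrite !mulr_ge0.
have sN1 : 1 <= Num.sqrt N%:R :> R by rewrite -[X in X <= _]sqrtr1 ler_wsqrtr // ler1n.
have sN2 : Num.sqrt N%:R ^+ 2 = N%:R :> R by rewrite sqr_sqrtr.
have NL : (N < L * L)%N.
  rewrite -(ltr_nat R) natrM -sN2 expr2.
  by apply: ltr_pM; rewrite ?sqrtr_ge0 // /L truncnS_gt.
have Lle : L%:R <= 2 * Num.sqrt N%:R :> R.
  rewrite /L -natr1; have := truncn_le (Num.sqrt (N%:R : R)).
  by rewrite sqrtr_ge0 => h; lra.
have pointwise x (a b : R) : tri a b `<=` tri N%:R N%:R ->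
    `|\sum_(p \in tri_idx a b) c p * f p x| ^+ 2
    <= K * \sum_(0 <= j < N) block_sqr L (row j x).
  move=> abN; have TA : tri_idx a b `<=` A.
    by move=> p [p0 pab]; split => //; exact: abN.
  rewrite real_normK ?num_real // (@fsbig_rows _ _ N); first last.
  - by move=> p /TA; exact: tri_idx_bound.
  - by move=> p [].
  apply: le_trans (@sqr_sum_le _ _ _ N _ _) _; first by rewrite size_iota subn0.
  rewrite /K -mulrA; apply: ler_wpM2l => //; rewrite mulr_sumr.
  apply: ler_sum => j _.
  have [i k ik|m mN mE] := @downset_sum_prefix R
      (fun i => (i.+1, j.+1) \in tri_idx a b) N.
    rewrite !inE => -[_ kj]; split => //; apply: tri_le kj => /=.
    by rewrite ler0n ler_nat.
  have -> : \sum_(0 <= i < N | (i.+1, j.+1) \in tri_idx a b)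
      c (i.+1, j.+1) * f (i.+1, j.+1) x
      = \sum_(0 <= i < N | (i.+1, j.+1) \in tri_idx a b) row j x i.
    apply: eq_bigr => i; rewrite inE => /TA Aij.
    by rewrite /row /c' patchT // inE.
  rewrite mE; apply: sqr_prefix_le; exact: leq_ltn_trans mN NL.
have rowL2 j i : f (i.+1, j.+1) \in Lfun mu 2%:E by exact: f2.
have roworth j i k : (\int[mu]_x (f (i.+1, j.+1) x * f (k.+1, j.+1) x)%:E)%E
    = (if i == k then 1 else 0)%E.
  by rewrite forth // xpair_eqE eqxx andbT eqSS.
have mrow j : measurable_fun setT (fun x => (block_sqr L (row j x))%:E).
  apply/measurable_EFinP.
  exact: (measurable_block_sqr _ (fun i => f (i.+1, j.+1)) (rowL2 j)).
have row0 j x : (0 <= (block_sqr L (row j x))%:E)%E.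
  by rewrite lee_fin block_sqr_ge0.
have sumc : \sum_(p \in A) `|c p| ^+ 2
    = \sum_(0 <= j < N) \sum_(0 <= i < L * L) c' (i.+1, j.+1) ^+ 2.
  rewrite (@fsbig_rows _ _ N); [|by move=> p []|by move=> p /tri_idx_bound].
  apply: eq_bigr => j _.
  rewrite (big_cat_nat (leq0n N) (ltnW NL)) /= [X in _ = _ + X]big_nat_cond.
  rewrite [X in _ = _ + X]big1 ?addr0 => [|i /andP[/andP[Ni _] _]]; last first.
    rewrite /c' patchN ?expr0n //; apply/negP; rewrite inE => /tri_idx_bound.
    by rewrite /= ltnNge Ni.
  rewrite big_mkcond; apply: eq_bigr => i _; rewrite /c' /patch.
  by case: ifP => _; rewrite ?expr0n // real_normK // num_real.
apply: (@le_trans _ _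
    (\int[mu]_x (K%:E * \sum_(0 <= j < N) (block_sqr L (row j x))%:E))%E).
  apply: ge0_le_integral_nomeas => x; last first.
    apply: ub_ereal_sup => _ [a [b [a0 b0 abN ->]]].
    by rewrite sumEFin -EFinM lee_fin pointwise.
  (* The degenerate triangle shows that the supremum is nonnegative. *)
  pose v : R := `|\sum_(p \in tri_idx (0 : R) 0) c p * f p x| ^+ 2.
  apply: (@le_trans _ _ v%:E); first by rewrite lee_fin exprn_ge0.
  apply: ereal_sup_ubound; exists 0, 0; split => // _ [s [t [_ _ _ ->]]].
  by exists 0, 0; split; rewrite ?addr0 ?mulr0 ?mul0r.
rewrite ge0_integralZl_EFin //; last first.
- exact: emeasurable_sum.
- by move=> x _; exact: sume_ge0.
rewrite ge0_integral_sum //.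
under eq_bigr => j _.
  rewrite (integral_block_sqr _ _ (rowL2 j) (roworth j)); over.
rewrite sumEFin -mulr_sumr -sumc -EFinM lee_fin mulrA.
apply: ler_wpM2r; first by apply: sumr_ge0 => p _; exact: sqr_ge0.
have NsN : N%:R * Num.sqrt N%:R <= N%:R `^ (ln (2 + Num.sqrt 3) / ln 2) :> R.
  have -> : N%:R * Num.sqrt N%:R = N%:R `^ (3 / 2) :> R.
    rewrite (_ : 3 / 2 = 1 + 2^-1); last lra.
    rewrite powRD ?powRr1 ?powR12_sqrt //.
    by apply/implyP => _; rewrite pnatr_eq0 -lt0n.
  by apply: ler_powR; rewrite ?ler1n ?exponent_ge.
rewrite /K; nra.
Qed.
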